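(* Let $c$ be a positive real number. There exist constants $0 < \sigma \leq 1/2$ and $C_1 > 0$ depending only on $c$ such that the following holds. Let $d \geq 1$ be a natural number, let $A$ be a finite non-empty subset of $\mathbb{R}^d$ and let $\mathscr{L} \in \mathrm{GL}_d(\mathbb{R})$ be an invertible linear transformation. If \[ |A + \mathscr{L}(A)| \leq c|A|, \] then there exist parallel lines $l_1, l_2, \dots, l_r$ in $\mathbb{R}^d$ (with $r \geq 1$) such that \[ |A \cap l_1| \geq \dots \geq |A \cap l_r| \geq |A \cap l_1|^{1/2} \geq C_1^{-1}|A|^{\sigma} \] and \[ |A \setminus (l_1 \cup l_2 \cup \dots \cup l_r)| < C_1 c^6 |A|^{1-\sigma}. \]
   Context: For $A,B \subseteq \mathbb{R}^d$, $A+B = \{a+b : a\in A, b \in B\}$, and $\mathscr{L}(A) = \{\mathscr{L}(a) : a \in A\}$. The parallel lines $l_1,\dots,l_r$ are (affine) and pairwise distinct. *)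

(* Defs.v *)
From HB Require Import structures.
From mathcomp Require Import all_boot all_order all_algebra.
From mathcomp Require Import finmap.
From mathcomp Require Import boolp classical_sets reals exp.

Set Implicit Arguments.
Unset Strict Implicit.
Unset Printing Implicit Defensive.

Import Order.TTheory GRing.Theory Num.Theory.

Local Open Scope fset_scope.
Local Open Scope classical_set_scope.
Local Open Scope ring_scope.

(* R^d is the space 'cV[R]_d of column vectors, on which matrices act on the
   left; finite subsets of R^d are finmap's {fset 'cV[R]_d}. *)

Definition sumset (R : realType) (d : nat) (A B : {fset 'cV[R]_d}) :
    {fset 'cV[R]_d} :=
  [fset (a + b)%R | a in A, b in B].

Definition linimage (R : realType) (d : nat) (L : 'M[R]_d)
    (A : {fset 'cV[R]_d}) : {fset 'cV[R]_d} :=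
  [fset (L *m a)%R | a in A].

(* This is an actual line only when v != 0. *)
Definition line (R : realType) (d : nat) (p v : 'cV[R]_d) : set 'cV[R]_d :=
  [set p + t *: v | t in [set: R]].

(* Affine lines with a common direction; distinctness is not included. *)
Definition parallel_lines (R : realType) (d r : nat)
    (l : 'I_r -> set 'cV[R]_d) : Prop :=
  exists2 v : 'cV[R]_d, v != 0 &
    forall i : 'I_r, exists p : 'cV[R]_d, l i = line p v.

Definition card_in (R : realType) (d : nat) (A : {fset 'cV[R]_d})
    (S : set 'cV[R]_d) : nat :=
  #|` [fset x in A | x \in S] |.

(* Main.v *)
Require Import Defs.
From HB Require Import structures.
From mathcomp Require Import all_boot all_order all_algebra.
From mathcomp Require Import finmap zify ring.
From mathcomp Require Import boolp classical_sets reals exp.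

Set Implicit Arguments.
Unset Strict Implicit.
Unset Printing Implicit Defensive.

Import Order.TTheory GRing.Theory Num.Theory.

Local Open Scope fset_scope.
Local Open Scope ring_scope.

(** Why the theorem is true.  Let N = |A|.  Ruzsa's triangle inequality turns
    |A + L(A)| <= c N into |A - A| <= c^2 N <= K N.  Everything then rests on
    one fact about small doubling ([rich_line]): some line contains at least a
    constant times N^(2 sigma) points of A, where sigma > 0 depends only on K.

    That fact is usually read off from Freiman's theorem, but a line needs far
    less than a generalised progression.  Petridis' form of the Pluennecke
    inequality and Ruzsa's covering lemma ([small_doubling_core]) give a dense
    X in A whose difference set D = X - X has D + D contained in T + D with
    |T| <= K^5.  This has two consequences.

    - D is closed under doubling up to T, so an element b of D has a binary
      expansion 2 b = t_0 + b_1, 2 b_1 = t_1 + b_2, ... with digits in T.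
      If |D| > |T|^k, two elements share their first k digits, and their
      difference v satisfies 2^i v in D - D for all i <= k
      ([common_binary_digits]).
    - The iterated sumsets of D grow polynomially: the m-fold sumset lies in
      B + D, where B consists of the combinations of elements of T with
      coefficients at most m, so that |B| <= (m+1)^|T|.

    Writing j < 2^k in base two puts the progression {j v : j < 2^k} in the
    2k-fold sumset of D, so adding it to X multiplies the size only by a
    polynomial in k ([small_growth_progression]).  Since the progression has
    2^k terms and 2^k can be as large as a power of N, the sums x + j v collide massively,
    which forces many points of X onto one line in direction v.

    Finally let n be the largest number of points of A on a line in that
    direction and m the number of lines in that direction that meet A.  Then
    n m <= |A - A| <= K N: translating the richest line by minus a point of
    each line gives m disjoint sets of size n.  The lines with fewer than
    n^(1/2) points carry at most m n^(1/2) <= K N / n^(1/2) points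
    ([parallel_line_cover]), and n^(1/2) is at least a constant times
    N^sigma. *)

(** * Counting by fibres *)

Lemma card_imfset_inj (T W : choiceType) (f : T -> W) (A : {fset T}) :
  injective f -> #|` [fset f x | x in A]| = #|` A|.
Proof. by move=> inj; rewrite card_imfset. Qed.

Lemma card_imfset_leq (T W : choiceType) (f : T -> W) (A : {fset T}) :
  (#|` [fset f x | x in A]| <= #|` A|)%N.
Proof. exact: leq_imfset_card. Qed.

Lemma card_fibers_ge (T W : choiceType) (f : T -> W) (n : nat) (Y : {fset W})
    (P : {fset T}) :
  (forall w, w \in Y -> n <= #|` [fset p in P | f p == w]|)%N ->
  (n * #|` Y| <= #|` P|)%N.
Proof.
elim/fset1U_rect: Y P => [|w Y wY IH] P hP; first by rewrite cardfs0 muln0.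
rewrite cardfsU1 wY mulnDr muln1 -(cardfsID [fset p in P | f p == w] P).
apply: leq_add.
  apply: leq_trans (hP w (fset1U1 _ _)) _; apply: fsubset_leq_card.
  by apply/fsubsetP => p; rewrite !inE => /andP[-> ->].
apply: IH => w' w'Y; apply: leq_trans (hP w' _) _; first by rewrite !inE w'Y orbT.
apply: fsubset_leq_card; apply/fsubsetP => p; rewrite !inE => /andP[-> /eqP ->].
by rewrite eqxx /= !andbT; apply: contraNneq wY => <-.
Qed.

Lemma card_fibers_le (T W : choiceType) (f : T -> W) (n : nat) (Y : {fset W})
    (P : {fset T}) :
  (forall p, p \in P -> f p \in Y) ->
  (forall w, w \in Y -> #|` [fset p in P | f p == w]| <= n)%N ->
  (#|` P| <= n * #|` Y|)%N.
Proof.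
elim/fset1U_rect: Y P => [|w Y wY IH] P PY hP.
  rewrite cardfs0 muln0 leqn0 cardfs_eq0; apply: contraT => /fset0Pn[p /PY].
  by rewrite inE.
rewrite cardfsU1 wY mulnDr muln1 -(cardfsID [fset p in P | f p == w] P).
apply: leq_add.
  apply: leq_trans (hP w (fset1U1 _ _)); apply: fsubset_leq_card.
  by apply/fsubsetP => p; rewrite !inE => /andP[_].
apply: IH => [p|w' w'Y].
  by rewrite !inE => /andP[+ pP]; have := PY p pP; rewrite pP !inE => /orP[->|].
apply: leq_trans (hP w' _); last by rewrite !inE w'Y orbT.
apply: fsubset_leq_card; apply/fsubsetP => p; rewrite !inE.
by move=> /andP[/andP[_ ->]].
Qed.

Lemma card_fsetM (T W : choiceType) (A : {fset T}) (B : {fset W}) :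
  #|` A `*` B| = (#|` A| * #|` B|)%N.
Proof.
have fib a : a \in A -> #|` [fset p in A `*` B | p.1 == a]| = #|` B|.
  move=> aA; have inj : injective (fun b : W => (a, b)) by move=> b b' [].
  rewrite -(card_imfset_inj B inj); congr #|` _|; apply/fsetP => -[x y].
  rewrite !inE /=; apply/andP/imfsetP => /= [[/andP[_ yB] /eqP ->]|[b bB [-> ->]]].
    by exists y.
  by rewrite aA bB.
apply/eqP; rewrite mulnC eqn_leq; apply/andP; split.
  apply: (@card_fibers_le _ _ fst) => [p|a aA]; last by rewrite fib.
  by rewrite in_fsetM => /andP[].
by apply: (@card_fibers_ge _ _ fst) => a aA; rewrite fib.
Qed.

(** * Finite sumsets in an abelian group *)

Definition addfs (V : zmodType) (A B : {fset V}) : {fset V} :=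
  [fset a + b | a in A, b in B].
Definition oppfs (V : zmodType) (A : {fset V}) : {fset V} :=
  [fset - a | a in A].

Local Notation "A :+ B" := (addfs A B) (at level 50, left associativity).
Local Notation "A :- B" := (addfs A (oppfs B)) (at level 50, left associativity).

Lemma addfsP (V : zmodType) (A B : {fset V}) (x : V) :
  reflect (exists a b, [/\ a \in A, b \in B & x = a + b]) (x \in A :+ B).
Proof.
apply: (iffP idP) => [/imfset2P[a /= aA [b /= bB ->]]|[a [b [aA bB ->]]]].
  by exists a, b.
by apply/imfset2P; exists a => //; exists b.
Qed.

Lemma mem_addfs (V : zmodType) (A B : {fset V}) (a b : V) :
  a \in A -> b \in B -> a + b \in A :+ B.
Proof. by move=> aA bB; apply/addfsP; exists a, b. Qed.

Lemma mem_oppfs (V : zmodType) (A : {fset V}) (a : V) :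
  (- a \in oppfs A) = (a \in A).
Proof. by rewrite (mem_imfset _ _ oppr_inj). Qed.

Lemma in_oppfs (V : zmodType) (A : {fset V}) (a : V) :
  (a \in oppfs A) = (- a \in A).
Proof. by rewrite -[RHS]mem_oppfs opprK. Qed.

Lemma card_oppfs (V : zmodType) (A : {fset V}) : #|` oppfs A| = #|` A|.
Proof. exact: card_imfset_inj oppr_inj. Qed.

Lemma subfsP (V : zmodType) (A B : {fset V}) (x : V) :
  reflect (exists a b, [/\ a \in A, b \in B & x = a - b]) (x \in A :- B).
Proof.
apply: (iffP (addfsP _ _ _)) => [[a [b [aA bB ->]]]|[a [b [aA bB ->]]]].
  by exists a, (- b); rewrite opprK -in_oppfs.
by exists a, (- b); rewrite in_oppfs opprK.
Qed.

Lemma mem_subfs (V : zmodType) (A B : {fset V}) (a b : V) :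
  a \in A -> b \in B -> a - b \in A :- B.
Proof. by move=> aA bB; apply: mem_addfs; rewrite ?in_oppfs ?opprK. Qed.

Lemma addfsS (V : zmodType) (A A' B B' : {fset V}) :
  A `<=` A' -> B `<=` B' -> A :+ B `<=` A' :+ B'.
Proof.
move=> /fsubsetP sA /fsubsetP sB; apply/fsubsetP => x /addfsP[a [b [aA bB ->]]].
by apply: mem_addfs; [apply: sA|apply: sB].
Qed.

Lemma oppfsS (V : zmodType) (A A' : {fset V}) : A `<=` A' -> oppfs A `<=` oppfs A'.
Proof. by move=> /fsubsetP sA; apply/fsubsetP => x; rewrite !in_oppfs => /sA. Qed.

Lemma addfsC (V : zmodType) (A B : {fset V}) : A :+ B = B :+ A.
Proof.
by apply/fsetP => x; apply/addfsP/addfsP => -[a [b [aA bB ->]]];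
  exists b, a; rewrite addrC.
Qed.

Lemma addfsA (V : zmodType) (A B C : {fset V}) : A :+ (B :+ C) = A :+ B :+ C.
Proof.
apply/fsetP => x; apply/addfsP/addfsP.
  move=> [a [y [aA /addfsP[b [c [bB cC ->]]] ->]]].
  by exists (a + b), c; rewrite addrA mem_addfs.
move=> [y [c [/addfsP[a [b [aA bB ->]]] cC ->]]].
by exists a, (b + c); rewrite addrA mem_addfs.
Qed.

Lemma card_addfs_le (V : zmodType) (A B : {fset V}) :
  (#|` A :+ B| <= #|` A| * #|` B|)%N.
Proof.
suff -> : A :+ B = [fset p.1 + p.2 | p in A `*` B].
  by rewrite -card_fsetM card_imfset_leq.
apply/fsetP => x; apply/addfsP/imfsetP => /=.
  by move=> [a [b [aA bB ->]]]; exists (a, b); rewrite ?in_fsetM ?aA.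
by move=> [[a b]]; rewrite in_fsetM => /andP[aA bB] ->; exists a, b.
Qed.

Lemma leq_card_translate (V : zmodType) (A B : {fset V}) (x : V) :
  (forall b, b \in B -> b + x \in A) -> (#|` B| <= #|` A|)%N.
Proof.
move=> h; rewrite -(card_imfset_inj _ (addIr x)); apply: fsubset_leq_card.
by apply/fsubsetP => y /imfsetP[b /= /h hb ->].
Qed.

Lemma card_addfsl (V : zmodType) (A B : {fset V}) (a : V) :
  a \in A -> (#|` B| <= #|` A :+ B|)%N.
Proof.
by move=> aA; apply: (@leq_card_translate _ _ _ a) => b bB; rewrite addrC mem_addfs.
Qed.

(** * Ruzsa's and Petridis' inequalities *)

(** Map (u, w) to u - w on (X + Y) x (X + Z): the fibre over y - z contains
    the |X| pairs (x + y, x + z). *)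
Lemma ruzsa_triangle (V : zmodType) (X Y Z : {fset V}) :
  (#|` X| * #|` Y :- Z| <= #|` X :+ Y| * #|` X :+ Z|)%N.
Proof.
rewrite -[leqRHS]card_fsetM.
apply: (@card_fibers_ge _ _ (fun p : V * V => p.1 - p.2)) => w /subfsP[y [z [yY zZ ->]]].
have inj : injective (fun x : V => (x + y, x + z)) by move=> a b [/addIr].
rewrite -(card_imfset_inj _ inj); apply: fsubset_leq_card.
apply/fsubsetP => _ /imfsetP[x /= xX ->].
rewrite in_fset /= inE /= in_fsetM !mem_addfs //=.
by rewrite opprD addrACA subrr add0r.
Qed.

(** A non-empty subset X of A minimising |X + B| / |X|; the quotients are
    compared after clearing denominators. *)
Lemma petridis_minimizer (V : zmodType) (A B : {fset V}) :
  A != fset0 ->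
  exists X : {fset V}, [/\ X `<=` A, X != fset0,
    (#|` X :+ B| * #|` A| <= #|` A :+ B| * #|` X|)%N &
    forall Z : {fset V}, Z `<=` X -> (#|` X :+ B| * #|` Z| <= #|` Z :+ B| * #|` X|)%N].
Proof.
elim/finSet_rect: A => A IH A0.
have [min|/existsNP[Z /not_implyP[ZA /negP]]] := pselect (forall Z : {fset V},
    Z `<=` A -> (#|` A :+ B| * #|` Z| <= #|` Z :+ B| * #|` A|)%N).
  by exists A.
rewrite -ltnNge => ltZ.
have Z0 : Z != fset0.
  by apply: contraTneq ltZ => ->; rewrite cardfs0 muln0.
have ZpA : Z `<` A.
  by rewrite fproperEneq ZA andbT; apply: contraTneq ltZ => ->; rewrite ltnn.
have [X [XZ X0 leX minX]] := IH Z ZpA Z0.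
exists X; split=> //; first exact: fsubset_trans ZA.
have Zgt0 : (0 < #|` Z|)%N by rewrite cardfs_gt0.
nia.
Qed.

(** Induction on C.  Adding c to C enlarges X + C by the elements of X outside
    Z = {x in X : x + c in X + C}, while X + B + C grows at most by the
    elements of X + B outside Z + B.  Minimality of X applied to Z bounds the
    second increase by |X + B| / |X| times the first. *)
Lemma petridis (V : zmodType) (X B : {fset V}) :
  (forall Z : {fset V}, Z `<=` X ->
     #|` X :+ B| * #|` Z| <= #|` Z :+ B| * #|` X|)%N ->
  forall C : {fset V}, (#|` X :+ B :+ C| * #|` X| <= #|` X :+ B| * #|` X :+ C|)%N.
Proof.
move=> min; elim/fset1U_rect => [|c C cC IH].
  have -> : X :+ B :+ fset0 = fset0.
    by apply/fsetP => x; apply/addfsP; rewrite inE => -[a [b []]].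
  by rewrite cardfs0.
pose Z := [fset x in X | x + c \in X :+ C].
have ZX : Z `<=` X by apply/fsubsetP => x; rewrite !inE => /andP[].
have ZB : Z :+ B `<=` X :+ B by apply: addfsS.
(* X + (C + c) contains the disjoint sets X + C and (X \ Z) + c. *)
have new : (#|` X :+ C| + #|` X `\` Z| <= #|` X :+ (c |` C)|)%N.
  have inj : injective (fun x : V => x + c) by exact: addIr.
  rewrite -(card_imfset_inj (X `\` Z) inj) -cardfsUI.
  rewrite (_ : _ `&` _ = fset0) ?cardfs0 ?addn0.
    apply: fsubset_leq_card; apply/fsubsetP => x /fsetUP[|/imfsetP[a /= + ->]].
      by apply/fsubsetP/addfsS; rewrite ?fsubsetUr.
    by rewrite inE => /andP[_ aX]; rewrite mem_addfs ?fset1U1.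
  apply/fsetP => x; rewrite !inE; apply/negP => /andP[xXC /imfsetP[a /=]].
  by rewrite !inE => /andP[/nandP[/negP//|] aC aX] xa; move: aC; rewrite -xa xXC.
(* Z + B + c already lies in X + B + C, so only (X + B) \ (Z + B) is new. *)
have old : (#|` X :+ B :+ (c |` C)| <= #|` X :+ B :+ C| + #|` (X :+ B) `\` (Z :+ B)|)%N.
  have inj : injective (fun x : V => x + c) by exact: addIr.
  rewrite -(card_imfset_inj ((X :+ B) `\` (Z :+ B)) inj).
  rewrite -cardfsUI; apply: leq_trans (leq_addr _ _); apply: fsubset_leq_card.
  apply/fsubsetP => _ /addfsP[y [d [yXB /fset1UP[->|dC] ->]]]; last first.
    by rewrite inE mem_addfs.
  have [|yZB] := boolP (y \in Z :+ B); last first.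
    by apply/fsetUP; right; apply/imfsetP; exists y; rewrite //= inE yZB.
  move=> /addfsP[z [b [+ bB ->]]]; rewrite !inE => /andP[_ /addfsP[x [e [xX eC zc]]]].
  by rewrite -addrA [b + c]addrC addrA zc -addrA [e + b]addrC addrA !mem_addfs.
have /fsetIidPr XZ := ZX; have /fsetIidPr XBZ := ZB.
have cX := cardfsID Z X; have cXB := cardfsID (Z :+ B) (X :+ B).
rewrite XZ in cX; rewrite XBZ in cXB.
have gain : (#|` (X :+ B) `\` (Z :+ B)| * #|` X| <= #|` X :+ B| * #|` X `\` Z|)%N.
  rewrite -(leq_add2l (#|` Z :+ B| * #|` X|)) -mulnDl cXB -{1}cX mulnDr leq_add2r.
  exact: min.
apply: leq_trans (leq_mul old (leqnn _)) _; rewrite mulnDl.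
apply: leq_trans (leq_add IH gain) _; rewrite -mulnDr.
exact: leq_mul.
Qed.

(** Take T maximal in U such that the translates t + X are disjoint: then
    |T| |X| <= |U + X|, and a u in U whose translate meets t + X lies in
    t + X - X.  T is built greedily, one element of U at a time. *)
Lemma ruzsa_covering (V : zmodType) (X U : {fset V}) (K : nat) :
  X != fset0 -> (#|` U :+ X| <= K * #|` X|)%N ->
  exists T : {fset V}, (#|` T| <= K)%N /\ U `<=` T :+ (X :- X).
Proof.
move=> X0 hU.
suff [T [TU UT TX]] : exists T : {fset V}, [/\ T `<=` U, U `<=` T :+ (X :- X) &
    (#|` T| * #|` X| <= #|` T :+ X|)%N].
  exists T; split=> //.
  rewrite -(leq_pmul2r (m := #|` X|)) ?cardfs_gt0 //.
  by apply: leq_trans TX (leq_trans _ hU); apply/fsubset_leq_card/addfsS.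
elim/fset1U_rect: U {hU} => [|u U uU [T [TU UT TX]]].
  by exists fset0; rewrite !fsub0set cardfs0.
have sD Y : Y `<=` Y :+ (X :- X).
  have /fset0Pn[x xX] := X0; apply/fsubsetP => y yY.
  by rewrite -[y]addr0 -(subrr x) mem_addfs ?mem_subfs.
have [uT|uT] := boolP (u \in T :+ (X :- X)).
  exists T; split=> //; first by apply: fsubset_trans TU _; rewrite fsubsetUr.
  by rewrite fsubUset fsub1set uT.
exists (u |` T); split.
- exact: fsetUS.
- rewrite fsubUset (fsubset_trans _ (sD _)) ?fsub1set ?fset1U1 //=.
  by apply: fsubset_trans UT _; apply: addfsS; rewrite ?fsubsetUr.
have inj : injective (fun x : V => u + x) by exact: addrI.
apply: (@leq_trans #|` [fset u + x | x in X] `|` (T :+ X)|); last first.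
  apply: fsubset_leq_card; apply/fsubsetP => x /fsetUP[/imfsetP[y /= yX ->]|].
    by rewrite mem_addfs ?fset1U1.
  by apply/fsubsetP/addfsS; rewrite ?fsubsetUr.
have uT' : u \notin T by apply: contraNN uT; apply/fsubsetP.
rewrite cardfsU1 uT' cardfsU (card_imfset_inj _ inj) (_ : _ `&` _ = fset0).
  by rewrite cardfs0 subn0 mulnDl mul1n leq_add2l.
apply/fsetP => y; rewrite !inE; apply/negP => /andP[/imfsetP[x /= xX ->]].
move=> /addfsP[t [x' [tT x'X e]]]; case/negP: uT.
apply/addfsP; exists t, (x' - x); split=> //; first exact: mem_subfs.
by rewrite addrA -e addrK.
Qed.

(** * A dense subset whose difference set is nearly closed under addition *)

(** For the minimiser X with B = - A, each further summand - A multiplies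
    |X + C| by at most K, so |X - 2X| <= K^2 |X| and |X - 3X| <= K^3 |X|.  The
    triangle inequality then gives |3X - 2X| <= K^5 |X|, which is what the
    covering lemma needs to cover D + D by translates of D = X - X. *)
Lemma small_doubling_core (V : zmodType) (A : {fset V}) (K : nat) :
  A != fset0 -> (#|` A :- A| <= K * #|` A|)%N ->
  exists X T : {fset V},
    [/\ X `<=` A, (#|` A| <= K * #|` X|)%N, (#|` X :- X| <= K * #|` X|)%N,
        (#|` T| <= K ^ 5)%N &
        (X :- X) :+ (X :- X) `<=` T :+ (X :- X)].
Proof.
move=> A0 hA.
have [X [XA X0 leX minX]] := petridis_minimizer (oppfs A) A0.
have Agt0 : (0 < #|` A|)%N by rewrite cardfs_gt0.
have Xgt0 : (0 < #|` X|)%N by rewrite cardfs_gt0.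
have XAK : (#|` X :- A| <= K * #|` X|)%N.
  by rewrite -(leq_pmul2r Agt0) (leq_trans leX) // mulnAC leq_mul.
have step C : (#|` X :- A :+ C| <= K * #|` X :+ C|)%N.
  rewrite -(leq_pmul2r Xgt0); apply: leq_trans (petridis minX C) _.
  by apply: leq_trans (leq_mul XAK (leqnn _)) _; rewrite mulnAC.
have sX : oppfs X `<=` oppfs A by exact: oppfsS.
pose N := oppfs X.
have step' C : (#|` X :+ (N :+ C)| <= K * #|` X :+ C|)%N.
  rewrite addfsA; apply: leq_trans (step C); apply: fsubset_leq_card.
  by apply: addfsS => //; exact: addfsS.
have XX : (#|` X :+ N| <= K * #|` X|)%N.
  by apply: leq_trans XAK; apply/fsubset_leq_card/addfsS.
have X2 : (#|` X :+ (N :+ N)| <= K ^ 2 * #|` X|)%N.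
  apply: leq_trans (step' _) _.
  by rewrite expnS expn1 -mulnA leq_mul2l XX orbT.
have X3 : (#|` X :+ (N :+ (N :+ N))| <= K ^ 3 * #|` X|)%N.
  apply: leq_trans (step' _) _.
  by rewrite expnS -mulnA leq_mul2l X2 orbT.
have big : (#|` (X :- X) :+ (X :- X) :+ X| <= K ^ 5 * #|` X|)%N.
  rewrite -(leq_pmul2l Xgt0).
  apply: (@leq_trans (#|` X| * #|` (N :+ N) :- (N :+ (N :+ N))|)%N).
    rewrite leq_mul2l; apply/orP; right; apply: fsubset_leq_card.
    apply/fsubsetP => _ /addfsP[_ [e [/addfsP[_ [_ [/subfsP[a [b [aX bX ->]]]
      /subfsP[a' [b' [a'X b'X ->]]] ->]]] eX ->]]].
    have -> : a - b + (a' - b') + e = (- b - b') - (- a + (- a' - e)).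
      by rewrite !opprD !opprK !addrA [LHS](ACl (2*4*1*3*5)).
    by rewrite mem_subfs // ?mem_addfs // mem_oppfs.
  apply: leq_trans (ruzsa_triangle _ _ _) _.
  by apply: leq_trans (leq_mul X2 X3) _; rewrite mulnACA -expnD mulnA mulnC.
have [T [TK TD]] := ruzsa_covering X0 big.
exists X, T; split=> //.
by apply: leq_trans XAK; rewrite -(card_oppfs A); have /fset0Pn[x xX] := X0;
  apply: card_addfsl xX.
Qed.

(** * Progressions in iterated sumsets *)

Definition progression (V : zmodType) (d : V) (n : nat) : {fset V} :=
  [fset d *+ j | j in iota 0 n].

Lemma progressionP (V : zmodType) (d : V) (n : nat) (x : V) :
  reflect (exists2 j, (j < n)%N & x = d *+ j) (x \in progression d n).
Proof.
apply: (iffP idP) => [/imfsetP[j /= + ->]|[j jn ->]].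
  by rewrite mem_iota => jn; exists j.
by apply/imfsetP; exists j; rewrite //= mem_iota.
Qed.

(** All combinations of the elements of T with coefficients at most k.  It
    contains the k-fold sumset of T, and its size is polynomial in k. *)
Definition box (V : zmodType) (T : seq V) (k : nat) : {fset V} :=
  foldr (fun t B => progression t k.+1 :+ B) [fset 0] T.

Lemma card_progression_le (V : zmodType) (d : V) (n : nat) :
  (#|` progression d n| <= n)%N.
Proof.
apply: leq_trans (leq_imfset_card _ _ _) _; rewrite -[leqRHS](size_iota 0).
by apply: uniq_leq_size (enum_finmem_uniq _) _ => j; rewrite enum_finmemE.
Qed.

Lemma card_progression (V : zmodType) (d : V) (n : nat) :
  injective (fun j => d *+ j) -> #|` progression d n| = n.
Proof.
move=> inj; rewrite /progression card_imfset // -[RHS](size_iota 0).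
apply/perm_size/uniq_perm => [||j]; first exact: enum_finmem_uniq.
  exact: iota_uniq.
exact: enum_finmemE.
Qed.

Lemma card_box_le (V : zmodType) (T : seq V) (k : nat) :
  (#|` box T k| <= k.+1 ^ size T)%N.
Proof.
elim: T => [|t T IH] /=; first by rewrite cardfs1.
rewrite expnS; apply: leq_trans (card_addfs_le _ _) _.
by rewrite leq_mul // card_progression_le.
Qed.

Lemma mem0_box (V : zmodType) (T : seq V) (k : nat) : 0 \in box T k.
Proof.
elim: T => [|t T IH] /=; first by rewrite inE.
by rewrite -[0]addr0 mem_addfs //; apply/progressionP; exists 0%N.
Qed.

Lemma box_succ (V : zmodType) (T : seq V) (k : nat) : box T k `<=` box T k.+1.
Proof.
elim: T => [|t T IH] //=; apply: addfsS IH.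
apply/fsubsetP => x /progressionP[j jk ->]; apply/progressionP.
by exists j; rewrite // ltnW.
Qed.

Lemma mem_box_add (V : zmodType) (T : seq V) (k : nat) (t x : V) :
  t \in T -> x \in box T k -> t + x \in box T k.+1.
Proof.
elim: T x => [|t' T IH] x //=; rewrite inE => /orP[/eqP->|tT] /addfsP[y [z [yP zB ->]]].
  rewrite addrA mem_addfs //; last by apply: (fsubsetP (box_succ T k)).
  have /progressionP[j jk ->] := yP.
  by apply/progressionP; exists j.+1; rewrite // mulrS.
rewrite addrCA mem_addfs // ?IH //.
by have /progressionP[j jk ->] := yP; apply/progressionP; exists j; rewrite // ltnW.
Qed.

(** An extra summand from D costs one more unit of coefficient in T, so the
    iterated sumsets of D stay in a box plus a single D. *)
Lemma mem_box_growth (V : zmodType) (D T : {fset V}) (m : nat) (x y : V) :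
  D :+ D `<=` T :+ D -> x \in box T m :+ D -> y \in D -> x + y \in box T m.+1 :+ D.
Proof.
move=> /fsubsetP DT /addfsP[b [e [bB eD ->]]] yD.
have /addfsP[t [e' [tT e'D ee']]] := DT _ (mem_addfs eD yD).
by rewrite -addrA ee' addrA [b + t]addrC mem_addfs // mem_box_add.
Qed.

(** Base two: j d is a sum of at most k of the vectors 2^i d, each a sum of two
    elements of D, hence of 2k elements of D altogether. *)
Lemma binary_expansion_in_box (V : zmodType) (D T : {fset V}) (d : V) (k : nat) :
  D :+ D `<=` T :+ D -> 0 \in D ->
  (forall i, (i < k)%N -> d *+ 2 ^ i \in D :+ D) ->
  progression d (2 ^ k) `<=` box T k.*2 :+ D.
Proof.
move=> DT D0; elim: k => [|k IH] hd.
  apply/fsubsetP => x /progressionP[[|//] _ ->].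
  by rewrite mulr0n -[0]addr0 mem_addfs // mem0_box.
have {}IH := IH (fun i ik => hd i (ltnW ik)).
have up x : x \in box T k.*2 :+ D -> x \in box T k.+1.*2 :+ D.
  apply/fsubsetP; apply: addfsS => //; rewrite doubleS.
  exact: fsubset_trans (box_succ _ _) (box_succ _ _).
apply/fsubsetP => x /progressionP[j jk ->].
have [jk'|kj] := ltnP j (2 ^ k).
  by apply: up; apply: (fsubsetP IH); apply/progressionP; exists j.
have [e [e' [eD e'D ee']]] := addfsP _ _ _ (hd k (ltnSn k)).
rewrite -(subnK kj) mulrnDr ee' addrA doubleS.
apply: mem_box_growth => //; apply: mem_box_growth => //.
apply: (fsubsetP IH); apply/progressionP; exists (j - 2 ^ k)%N => //.
by rewrite ltn_subLR // addnn -mul2n -expnS.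
Qed.

(** Pigeonhole on binary digits.  tau b in T is the first digit of b and
    2 b - tau b in D is the remainder to be expanded further.  The most popular
    digit t is shared by more than s^k elements; the remainders 2 b - t are
    distinct because doubling is injective, and the differences of two such
    remainders are the doubles of the differences of the elements. *)
Lemma common_binary_digits (V : zmodType) (D T D' : {fset V}) (s k : nat) :
  (forall x : V, x *+ 2 = 0 -> x = 0) ->
  (forall b, b \in D -> b *+ 2 \in T :+ D) ->
  (#|` T| <= s)%N -> D' `<=` D -> (s ^ k < #|` D'|)%N ->
  exists b b', [/\ b \in D', b' \in D', b != b' &
    forall i, (i <= k)%N -> (b - b') *+ 2 ^ i \in D :- D].
Proof.
move=> tf DT Ts; elim: k D' => [|k IH] D' D'D ltD'.
  move: ltD'; rewrite expn0 => ltD'.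
  have /fset0Pn[b bD'] : D' != fset0 by rewrite -cardfs_gt0; apply: ltnW.
  have /fset0Pn[b'] : D' `\ b != fset0.
    by move: ltD'; rewrite (cardfsD1 b) bD' add1n ltnS cardfs_gt0.
  rewrite !inE => /andP[bb' b'D']; exists b, b'; split=> // [|i].
    by rewrite eq_sym.
  by rewrite leqn0 => /eqP ->; rewrite mulr1n mem_subfs // (fsubsetP D'D).
have digit b : b \in D -> exists2 t, t \in T & b *+ 2 - t \in D.
  move=> /DT/addfsP[t [e [tT eD ->]]]; exists t => //.
  by rewrite addrAC subrr add0r.
pose tau b := nth 0 T (find (fun t => b *+ 2 - t \in D) T).
have tauP b : b \in D' -> tau b \in T /\ b *+ 2 - tau b \in D.
  move=> /(fsubsetP D'D)/digit[t tT tD].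
  have hT : has (fun t => b *+ 2 - t \in D) T by apply/hasP; exists t.
  by split; [rewrite mem_nth // -has_find|exact: (nth_find 0 hT)].
have [t tT tbig] : exists2 t, t \in T & (s ^ k < #|` [fset b in D' | tau b == t]|)%N.
  apply: contrapT => no; move: ltD'; rewrite ltnNge => /negP; apply.
  rewrite expnSr; apply: (@leq_trans (s ^ k * #|` T|)%N); last by rewrite leq_mul.
  apply: (@card_fibers_le _ _ tau) => [b /tauP[]//|t tT].
  by rewrite leqNgt; apply/negP => lt; apply: no; exists t.
have inj : injective (fun b : V => b *+ 2 - t).
  move=> b b' /addIr/eqP; rewrite -subr_eq0 -mulrnBl => /eqP/tf/eqP.
  by rewrite subr_eq0 => /eqP.
pose D'' := [fset b *+ 2 - t | b in [fset b in D' | tau b == t]].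
have [||b [b' [bD bD' bb' hb]]] := IH D''.
- apply/fsubsetP => x /imfsetP[b /=]; rewrite !inE => /andP[bD' /eqP tb] ->.
  by rewrite -tb; case: (tauP b bD').
- by rewrite card_imfset_inj.
move: bD bD' bb' hb => /imfsetP[x /=]; rewrite !inE => /andP[xD' _] ->.
move=> /imfsetP[y /=]; rewrite !inE => /andP[yD' _] -> xy hb.
exists x, y; split=> //; first by apply: contraNneq xy => ->.
move=> [_|i /hb]; first by rewrite mulr1n mem_subfs // (fsubsetP D'D).
by rewrite opprB addrA subrK -mulrnBl -mulrnA -expnS.
Qed.

(** The progression lies in a box plus D and X lies in a translate of D, so
    X plus the progression lies in a translate of the next box plus D. *)
Lemma small_growth_progression (V : zmodType) (A : {fset V}) (K : nat) :
  (forall x : V, x *+ 2 = 0 -> x = 0) ->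
  A != fset0 -> (#|` A :- A| <= K * #|` A|)%N ->
  exists X : {fset V}, [/\ X `<=` A, (#|` A| <= K * #|` X|)%N &
    forall k, ((K ^ 5) ^ k < #|` X|)%N -> exists2 d, d != 0 &
      (#|` X :+ progression d (2 ^ k)| <= k.*2.+2 ^ (K ^ 5) * (K * #|` X|))%N].
Proof.
move=> tf A0 hA.
have [X [T [XA AX XX TK DT]]] := small_doubling_core A0 hA.
exists X; split=> // k ltk; set D := X :- X in XX DT *.
have /fset0Pn[x0 x0X] : X != fset0.
  by rewrite -cardfs_gt0; apply: leq_ltn_trans ltk.
have D0 : 0 \in D by rewrite -(subrr x0) mem_subfs.
(* Symmetry of D turns D - D, where the doubled differences live, into D + D. *)
have DN : oppfs D = D.
  apply/fsetP => x; rewrite in_oppfs.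
  apply/subfsP/subfsP => -[a [b [aX bX e]]]; exists b, a; split=> //.
    by rewrite -[x]opprK e opprB.
  by rewrite e opprB.
have XD : (#|` X| <= #|` D|)%N.
  by apply: (@leq_card_translate _ _ _ (- x0)) => x xX; rewrite mem_subfs.
have D2 b : b \in D -> b *+ 2 \in T :+ D.
  by move=> bD; apply: (fsubsetP DT); rewrite mulr2n mem_addfs.
have [b [b' [bD b'D bb' hb]]] :=
  common_binary_digits tf D2 TK (fsubset_refl D) (leq_trans ltk XD).
exists (b - b'); first by rewrite subr_eq0.
have PB : progression (b - b') (2 ^ k) `<=` box T k.*2 :+ D.
  by apply: binary_expansion_in_box => // i /ltnW/hb; rewrite DN.
apply: (@leq_trans #|` box T k.*2.+1 :+ D|).
  apply: (@leq_card_translate _ _ _ (- x0)) => _ /addfsP[x [p [xX pP ->]]].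
  rewrite addrAC addrC; apply: mem_box_growth => //; last by rewrite mem_subfs.
  exact: (fsubsetP PB).
apply: leq_trans (card_addfs_le _ _) _; apply: leq_mul => //.
apply: leq_trans (card_box_le _ _) _.
by rewrite leq_pexp2l.
Qed.

(** * Lines rich in points *)

Lemma fset_argmax (T : choiceType) (f : T -> nat) (Y : {fset T}) :
  Y != fset0 -> exists2 y0, y0 \in Y & forall y, y \in Y -> (f y <= f y0)%N.
Proof.
elim/fset1U_rect: Y => [|y Y yY IH]; first by rewrite eqxx.
move=> _.
have [->|/IH[y0 y0Y max]] := eqVneq (Y : {fset T}) fset0.
  by exists y; rewrite ?fset1U1 // => z; rewrite !inE orbF => /eqP ->.
have [le|lt] := leqP (f y) (f y0).
  exists y0; first by rewrite !inE y0Y orbT.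
  by move=> z /fset1UP[->//|/max].
exists y; first by rewrite fset1U1.
by move=> z /fset1UP[->//|/max le]; apply: leq_trans le (ltnW lt).
Qed.

(** With q = k / m, k + 1 <= m (q + 1) <= m 2^q, and 2^(q m) <= 2^k. *)
Lemma exp_dominates_poly (m : nat) :
  exists2 C, (0 < C)%N & forall k, (k.+1 ^ m <= C * 2 ^ k)%N.
Proof.
have [->|m0] := posnP m; first by exists 1%N => // k; rewrite mul1n expn_gt0.
exists (m ^ m)%N => [|k]; first by rewrite expn_gt0 m0.
apply: (@leq_trans ((m * 2 ^ (k %/ m)) ^ m)%N).
  rewrite leq_exp2r //; apply: leq_trans (ltn_ceil k m0) _.
  by rewrite mulnC leq_mul // ltn_expl.
by rewrite expnMn -expnM leq_mul // leq_exp2l // leq_divM.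
Qed.

Lemma in_line (R : realType) (d : nat) (p v : 'cV[R]_d) (x : 'cV[R]_d) :
  (x \in line p v) <-> exists t, x = p + t *: v.
Proof.
rewrite in_setE; split=> [[t _ <-]|[t ->]]; first by exists t.
by exists t.
Qed.

Lemma line_self (R : realType) (d : nat) (p v : 'cV[R]_d) : p \in line p v.
Proof. by apply/in_line; exists 0; rewrite scale0r addr0. Qed.

Lemma line_rebase (R : realType) (d : nat) (p q v : 'cV[R]_d) :
  q \in line p v -> line q v = line p v.
Proof.
move=> /in_line[t ->]; apply/seteqP; split=> x [u _ <-].
  by exists (t + u) => //; rewrite scalerDl addrA.
by exists (u - t) => //; rewrite scalerBl -addrA [t *: v + _]addrC subrK.
Qed.

Lemma card_in_mono (R : realType) (d : nat) (A B : {fset 'cV[R]_d})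
    (S : set 'cV[R]_d) :
  A `<=` B -> (card_in A S <= card_in B S)%N.
Proof.
move=> /fsubsetP AB; apply/fsubset_leq_card/fsubsetP => x; rewrite !inE.
by move=> /andP[/AB ->].
Qed.

(** A sum y = x + j v has x on the line through y in direction v and x
    determines j, so y has at most m representations. *)
Lemma card_mul_progression_le (R : realType) (d n m : nat) (X : {fset 'cV[R]_d})
    (v : 'cV[R]_d) :
  v != 0 -> (forall y, card_in X (line y v) <= m)%N ->
  (#|` X| * n <= m * #|` X :+ progression v n|)%N.
Proof.
move=> v0 hm.
have inj : injective (fun j : nat => v *+ j).
  by move=> i j /eqP; rewrite -!scaler_nat -subr_eq0 -scalerBl scaler_eq0 (negPf v0) orbF
    subr_eq0 eqr_nat => /eqP.
rewrite -{1}(card_progression n inj) -card_fsetM.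
apply: (@card_fibers_le _ _ (fun p => p.1 + p.2)) => [p|y _].
  by rewrite in_fsetM => /andP[] *; apply: mem_addfs.
apply: leq_trans (hm y).
have injf : {in [fset p in X `*` progression v n | p.1 + p.2 == y] &, injective fst}.
  move=> [x p] [x' p']; rewrite !inE /= => /andP[_ /eqP <-] /andP[_ /eqP].
  by move=> + xx'; rewrite xx' => /addrI ->.
rewrite -(card_in_imfset imfset_key injf); apply: fsubset_leq_card.
apply/fsubsetP => _ /imfsetP[[x p] /= + ->]; rewrite !inE /=.
move=> /andP[/andP[-> /progressionP[j _ ->]] /eqP <-] /=.
by apply/in_line; exists (- j%:R); rewrite scaleNr scaler_nat addrK.
Qed.

(** Let q = K^5.  Choose k with (2^q)^k < |X| <= (2^q)^(k+1); since q <= 2^q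
    there are enough elements for k common digits.  If n is the largest number
    of points of A on a line in the resulting direction, then
    2^k <= n K (2k+2)^q.  After squaring, a factor 2^k absorbs the polynomial
    (k+1)^(2q), which leaves 2^k <= C' n^2 and hence |X| <= (2 C' n^2)^q. *)
Lemma rich_line (K : nat) :
  exists2 C : nat, (0 < C)%N &
    forall (R : realType) (d : nat) (A : {fset 'cV[R]_d}),
      (0 < d)%N -> A != fset0 -> (#|` A :- A| <= K * #|` A|)%N ->
      exists p v : 'cV[R]_d, v != 0 /\
        (#|` A| <= C * card_in A (line p v) ^ (2 * K ^ 5))%N.
Proof.
have [q qE] : exists q, q = (K ^ 5)%N by exists (K ^ 5)%N.
have [C0 C0gt0 hC0] := exp_dominates_poly (q * 2).
have [K0|Kgt0] := posnP K.
  exists 1%N => // R d A _ A0; rewrite K0 leqn0 cardfs_eq0 => /eqP AA.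
  have /fset0Pn[a aA] := A0; have := mem_subfs aA aA.
  by rewrite AA inE.
have qgt0 : (0 < q)%N by rewrite qE expn_gt0 Kgt0.
pose C' := (K ^ 2 * 4 ^ q * C0)%N.
have C'gt0 : (0 < C')%N by rewrite !muln_gt0 !expn_gt0 Kgt0.
exists (K * (2 * C') ^ q)%N => [|R d A dgt0 A0 hA].
  by rewrite muln_gt0 Kgt0 expn_gt0 muln_gt0 C'gt0.
have tf (x : 'cV[R]_d) : x *+ 2 = 0 -> x = 0.
  by move=> /eqP; rewrite -scaler_nat scaler_eq0 pnatr_eq0 => /eqP.
have [X [XA AX]] := small_growth_progression tf A0 hA.
rewrite -!qE => hX.
have [X1|X1] := leqP #|` X| 1.
  (* Here |A| <= K, and any line through a point of A will do. *)
  have /fset0Pn[a aA] := A0; exists a, (const_mx 1); split.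
    apply/negP => /eqP/matrixP/(_ (Ordinal dgt0) ord0)/eqP.
    by rewrite !mxE oner_eq0.
  apply: leq_trans AX _; rewrite -mulnA leq_mul // (leq_trans X1) //.
  rewrite muln_gt0 !expn_gt0 muln_gt0 C'gt0 /= cardfs_gt0; apply/orP; left.
  by apply/fset0Pn; exists a; rewrite !inE aA line_self.
have [k /andP[lek ltk]] : exists k,
    ((2 ^ q) ^ k <= #|` X|.-1 < (2 ^ q) ^ k.+1)%N.
  (* The predecessor makes the lower bound on |X| strict. *)
  exists (trunc_log (2 ^ q) #|` X|.-1); apply: trunc_log_bounds.
    by rewrite -{1}(expn0 2) ltn_exp2l.
  by rewrite -ltnS prednK // ltnW.
have [v v0 hv] : exists2 v : 'cV[R]_d, v != 0 &
    (#|` X :+ progression v (2 ^ k)| <= k.*2.+2 ^ q * (K * #|` X|))%N.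
  apply: hX; rewrite -[ltnRHS](prednK (ltnW X1)) ltnS; apply: leq_trans lek.
  have [->|k0] := posnP k; first by rewrite !expn0.
  by rewrite leq_exp2r // ltnW // ltn_expl.
have Xgt0 := ltnW X1.
have [y maxy] : exists y, forall z,
    (card_in A (line z v) <= card_in A (line y v))%N.
  have [a aA amax] := fset_argmax (fun z => card_in A (line z v)) A0.
  exists a => z.
  have [z0|/fset0Pn[x]] := eqVneq [fset x in A | x \in line z v] fset0.
    by rewrite [leqLHS]/card_in z0 cardfs0.
  rewrite !inE => /andP[xA /line_rebase zx]; rewrite -zx; exact: amax.
exists y, v; split=> //; set n := card_in A (line y v) in maxy *.
have hn : (2 ^ k <= n * (K * (2 ^ q * k.+1 ^ q)))%N.
  have := @card_mul_progression_le _ _ (2 ^ k) n X v v0.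
  have hXn z : (card_in X (line z v) <= n)%N.
    exact: leq_trans (card_in_mono _ XA) (maxy z).
  move=> /(_ hXn) h; rewrite -(leq_pmul2l Xgt0); apply: leq_trans h _.
  apply: leq_trans (leq_mul (leqnn n) hv) _.
  by rewrite -doubleS -mul2n expnMn; lia.
have hn2 : (2 ^ k <= n ^ 2 * C')%N.
  have gt0 : (0 < 2 ^ k)%N by rewrite expn_gt0.
  rewrite -(leq_pmul2r gt0) -[leqLHS]/((2 ^ k) ^ 2)%N.
  have := hn; rewrite -(@leq_exp2r _ _ 2) // => /leq_trans; apply.
  rewrite !expnMn -!expnM {1}[(q * 2)%N]mulnC (expnM 2 2 q) /C' -!mulnA.
  by rewrite !leq_mul2l hC0 !orbT.
have XE : (#|` X| <= (2 * 2 ^ k) ^ q)%N.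
  by rewrite -expnS -expnM mulnC expnM -[leqLHS]prednK.
apply: leq_trans AX _; rewrite -mulnA leq_mul //; apply: leq_trans XE _.
by rewrite expnM -expnMn leq_exp2r // -mulnA leq_mul // mulnC.
Qed.

(** * Selecting the parallel lines *)

(** Order the lines in direction v with at least n^(1/2) points, where n is the
    largest number of points on such a line.  The other lines have at most q
    points each, where q^2 < n <= (q+1)^2, so with m lines in all the uncovered
    points number at most m q, while n m <= |A - A|. *)
Lemma parallel_line_cover (R : realType) (d : nat) (A : {fset 'cV[R]_d})
    (v : 'cV[R]_d) :
  v != 0 -> A != fset0 ->
  exists (r : nat) (l : 'I_r.+1 -> set 'cV[R]_d),
    [/\ parallel_lines l, injective l,
        (forall i j : 'I_r.+1, (i <= j)%N -> (card_in A (l j) <= card_in A (l i))%N),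
        (card_in A (l ord0) <= card_in A (l ord_max) ^ 2)%N &
        (forall p, (card_in A (line p v) <= card_in A (l ord0))%N) /\
        (card_in A (~` \bigcup_i l i)%classic ^ 2 * card_in A (l ord0) <=
          #|` A :- A| ^ 2)%N].
Proof.
move=> v0 A0; pose f := card_in A.
pose Ls := [fset line a v | a in A].
have lineL a : a \in A -> line a v \in Ls by move=> aA; apply/imfsetP; exists a.
have /fset0Pn[a0 a0A] := A0.
have Ls0 : Ls != fset0 by apply/fset0Pn; exists (line a0 v); exact: lineL.
have [lm lmL maxL] := fset_argmax f Ls0.
have maxf p : (f (line p v) <= f lm)%N.
  have [z0|/fset0Pn[x]] := eqVneq [fset x in A | x \in line p v] fset0.
    by rewrite [f (line p v)]/card_in z0 cardfs0.
  by rewrite !inE => /andP[xA /line_rebase <-]; apply/maxL/lineL.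
set n := f lm in maxL maxf.
have n0 : (0 < n)%N.
  apply: leq_trans (maxf a0); rewrite cardfs_gt0; apply/fset0Pn; exists a0.
  by rewrite !inE a0A line_self.
pose G := [fset l in Ls | (n <= f l ^ 2)%N].
have lmG : lm \in G by rewrite !inE lmL /= -/n expnS expn1 leq_pmulr.
pose ge l l' := (f l' <= f l)%N.
pose s := sort ge G.
have geT : total ge by move=> l l'; exact: leq_total.
have getr : transitive ge by move=> l2 l1 l3 h1 h2; exact: leq_trans h2 h1.
have sG : s =i G by move=> l; rewrite mem_sort.
have us : uniq s by rewrite sort_uniq fset_uniq.
have ss : sorted ge s by exact: sort_sorted.
have sgt0 : (0 < size s)%N by case: (s) (sG lm); rewrite ?lmG.
pose r := (size s).-1.
have sr : size s = r.+1 by rewrite prednK.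
pose l (i : 'I_r.+1) := nth lm s i.
have lG i : l i \in G by rewrite -sG mem_nth // sr.
have mono (i j : 'I_r.+1) : (i <= j)%N -> (f (l j) <= f (l i))%N.
  move=> ij; apply: (sorted_leq_nth getr (fun x => leqnn _) lm ss) => //;
    by rewrite inE sr.
have onto l' : l' \in G -> exists i, l i = l'.
  rewrite -sG => l's; have lt : (index l' s < r.+1)%N by rewrite -sr index_mem.
  by exists (Ordinal lt); rewrite /l nth_index.
have fl0 : f (l ord0) = n.
  apply/eqP; rewrite eqn_leq; apply/andP; split.
    by apply: maxL; have := lG ord0; rewrite !inE => /andP[].
  by have [i li] := onto lm lmG; rewrite /n -{1}li; exact: mono.
exists r, l; split.
- exists v => // i; have := lG i; rewrite !inE => /andP[/imfsetP[a /= _ ->] _].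
  by exists a.
- move=> i j /eqP; rewrite nth_uniq ?sr // => /eqP; exact: val_inj.
- exact: mono.
- by have := lG ord_max; rewrite -/f fl0 !inE => /andP[].
rewrite -/f fl0; split=> //.
(* The fibre over the line through a contains a - x for every x in A on the
   richest line, which passes through p. *)
have few : (n * #|` Ls| <= #|` A :- A|)%N.
  have /imfsetP[p /= pA lmp] := lmL.
  apply: (@card_fibers_ge _ _ (fun y => line (y + p) v)) => _ /imfsetP[a /= aA ->].
  have inj : injective (fun x => a - x) by move=> x y /addrI/oppr_inj.
  rewrite /n /f /card_in -(card_imfset_inj _ inj); apply: fsubset_leq_card.
  apply/fsubsetP => _ /imfsetP[x /= + ->]; rewrite !inE => /andP[xA].
  rewrite lmp => /in_line[t xt]; rewrite mem_subfs //=.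
  apply/eqP/line_rebase/in_line; exists (- t).
  by rewrite xt opprD scaleNr addrA [a - p - _]addrAC subrK.
have [q qlt leq] : exists2 q, (q ^ 2 < n)%N & (n <= q.+1 ^ 2)%N.
  elim: (n) n0 => // -[|m] IH _; first by exists 0%N.
  have [//|q lt le] := IH.
  have [le'|lt'] := leqP m.+2 (q.+1 ^ 2); first by exists q => //; apply: ltnW.
  by exists q.+1 => //; apply: leq_ltn_trans le _; rewrite ltn_exp2r.
have rest : (f (~` \bigcup_i l i)%classic <= q * #|` Ls|)%N.
  apply: (@card_fibers_le _ _ (fun x => line x v)) => [x|l' l'L].
    by rewrite !inE => /andP[/lineL].
  have [l'G|l'G] := boolP (l' \in G).
    rewrite (_ : [fset _ in _ | _] = fset0) ?cardfs0 //.
    apply/fsetP => x; rewrite !inE; apply/negP => /andP[/andP[xA]].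
    rewrite in_setE => xl /eqP xl'; apply: xl.
    have [i li] := onto l' l'G; exists i => //.
    by rewrite li -xl'; apply/set_mem/line_self.
  have : (f l' <= q)%N.
    rewrite -ltnS -(@ltn_exp2r _ _ 2) //.
    by apply: leq_trans leq; move: l'G; rewrite !inE l'L /= -ltnNge.
  apply: leq_trans; apply: fsubset_leq_card; apply/fsubsetP => x.
  by rewrite !inE => /andP[/andP[-> _] /eqP <-] /=; exact: line_self.
apply: (@leq_trans ((n * #|` Ls|) ^ 2)); last by rewrite leq_exp2r.
have restsq : (f (~` \bigcup_i l i)%classic ^ 2 <= (q * #|` Ls|) ^ 2)%N.
  by rewrite leq_exp2r.
apply: leq_trans (leq_mul restsq (leqnn n)) _.
rewrite !expnMn mulnAC leq_mul // -[leqRHS]/(n * n)%N leq_mul //.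
exact: ltnW.
Qed.

Local Open Scope fset_scope.
Local Open Scope classical_set_scope.
Local Open Scope ring_scope.

(** * The structure theorem *)

(** The triangle inequality with the set L(A), which has |A| elements, and
    both summands equal to A. *)
Lemma card_difference_le (R : realType) (d : nat) (A : {fset 'cV[R]_d})
    (L : 'M[R]_d) (c : R) :
  A != fset0 -> L \in unitmx -> 0 <= c ->
  (#|` sumset A (linimage L A)|)%:R <= c * (#|` A|)%:R ->
  (#|` A :- A|)%:R <= c ^+ 2 * (#|` A|)%:R.
Proof.
move=> A0 uL c0 hA.
have inj : injective (fun a : 'cV[R]_d => L *m a) by exact: can_inj (mulKmx uL).
have N0 : 0 < (#|` A|)%:R :> R by rewrite ltr0n cardfs_gt0.
have := ruzsa_triangle (linimage L A) A A.
rewrite [#|` linimage L A|]card_imfset_inj // (addfsC (linimage L A)).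
rewrite -[A :+ _]/(sumset _ _).
rewrite -(ler_nat R) !natrM => h; rewrite -(ler_pM2l N0); apply: le_trans h _.
rewrite -[leLHS]expr2 mulrCA -[X in _ ^+ 2 * X]expr2 -exprMn.
by rewrite lerXn2r // nnegrE ?mulr_ge0.
Qed.

Lemma card_sumset_ge (R : realType) (d : nat) (A B : {fset 'cV[R]_d}) :
  B != fset0 -> (#|` A| <= #|` sumset A B|)%N.
Proof. by move=> /fset0Pn[b bB]; rewrite [sumset _ _]addfsC; apply: card_addfsl bB. Qed.

Theorem theorem1p5 (R : realType) (c : R) (hc : 0 < c) :
  exists sigma C1 : R,
    [/\ 0 < sigma, sigma <= 2^-1, 0 < C1 &
      forall (d : nat) (A : {fset 'cV[R]_d}) (L : 'M[R]_d),
        (1 <= d)%N -> A != fset0 -> L \in unitmx ->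
        (#|` sumset A (linimage L A)|)%:R <= c * (#|` A|)%:R ->
        exists (r : nat) (l : 'I_r.+1 -> set 'cV[R]_d),
          [/\ parallel_lines l,
              injective l,
              (forall i j : 'I_r.+1, (i <= j)%N ->
                 (card_in A (l j) <= card_in A (l i))%N),
              ((card_in A (l ord0))%:R `^ (2^-1) <=
                 (card_in A (l ord_max))%:R :> R) /\
              C1^-1 * (#|` A|)%:R `^ sigma <=
                 (card_in A (l ord0))%:R `^ (2^-1) &
              (card_in A (~` \bigcup_i l i))%:R <
                C1 * c ^+ 6 * (#|` A|)%:R `^ (1 - sigma)]].
Proof.
pose K := (Num.truncn (c ^+ 2)).+1.
have cK : c ^+ 2 <= K%:R by rewrite ltW // truncnS_gt.
have [C Cgt0 hC] := rich_line K.
have q0 : (0 < K ^ 5)%N by rewrite expn_gt0.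
pose e : R := (2 * K ^ 5)%:R.
have e0 : 0 < e by rewrite ltr0n muln_gt0.
have e1 : 1 <= e by rewrite ler1n muln_gt0.
(* rich_line bounds |A| by C n^e; taking 1/e-th powers and then square roots
   gives this exponent. *)
pose sigma : R := 2^-1 / e.
have sigma0 : 0 < sigma by rewrite divr_gt0 // invr_gt0 ltr0n.
have CR0 : 0 < C%:R :> R by rewrite ltr0n.
have K1 : 1 <= K%:R :> R by rewrite ler1n.
exists sigma, (2 * K%:R * C%:R); split=> //.
- by rewrite ler_pdivrMr // ler_peMr // invr_ge0 ler0n.
- by rewrite !mulr_gt0 // (lt_le_trans ltr01).
move=> d A L d0 A0 uL hA.
have AAK : (#|` A :- A| <= K * #|` A|)%N.
  rewrite -(ler_nat R) natrM.
  apply: le_trans (card_difference_le A0 uL (ltW hc) hA) _.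
  by rewrite ler_wpM2r.
have N0 : 0 < (#|` A|)%:R :> R by rewrite ltr0n cardfs_gt0.
(* A sumset of A is at least as large as A, so the hypothesis forces c >= 1;
   hence c^6 >= 1. *)
have c1 : 1 <= c.
  rewrite -(ler_pM2r N0) mul1r; apply: le_trans hA.
  rewrite ler_nat; apply: card_sumset_ge.
  have /fset0Pn[a aA] := A0; apply/fset0Pn; exists (L *m a).
  by apply/imfsetP; exists a.
have [p [v [v0 rich]]] := hC R d A d0 A0 AAK.
have [r [l [par inj mono big [maxl rest]]]] := parallel_line_cover v0 A0.
exists r, l; set n := card_in A (l ord0) in big maxl rest *.
set E := card_in A (~` _) in rest *; set N := #|` A| in N0 AAK rich *.
set w : R := n%:R `^ (2^-1).
have w2 : w ^+ 2 = n%:R by rewrite /w powR12_sqrt // sqr_sqrtr.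
have w0 : 0 <= w by exact: powR_ge0.
have NCw : N%:R `^ sigma <= C%:R * w.
  have : N%:R <= C%:R * n%:R `^ e :> R.
    rewrite powR_mulrn // -natrX -natrM ler_nat; apply: leq_trans rich _.
    by rewrite leq_mul // leq_exp2r ?muln_gt0.
  move=> h; apply: le_trans (ge0_ler_powR (ltW sigma0) _ _ h) _;
    rewrite ?nnegrE ?ler0n ?mulr_ge0 ?powR_ge0 //.
  rewrite powRM ?powR_ge0 // -powRrM mulrCA divff ?gt_eqF // mulr1.
  rewrite ler_wpM2r // ler1_powR // ?ler1n //.
  by rewrite ler_pdivrMr // mul1r (le_trans _ e1) // invf_le1 // ler1n.
have wgt0 : 0 < w.
  rewrite lt_neqAle w0 andbT eq_sym; apply/negP => /eqP w00.
  by move: NCw; rewrite w00 mulr0 leNgt powR_gt0.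
split=> //.
  split.
    rewrite -/w -(@ler_pXn2r _ 2) // ?nnegrE // w2 -natrX ler_nat.
    exact: big.
  rewrite ler_pdivrMl ?mulr_gt0 // ?(lt_le_trans ltr01) //.
  apply: le_trans NCw _; by rewrite ler_wpM2r // ler_peMl // mulr_ege1 ?ler1n.
have EW : E%:R * w <= K%:R * N%:R.
  rewrite -(@ler_pXn2r _ 2) // ?nnegrE ?mulr_ge0 // exprMn w2.
  rewrite -natrM -!natrX -natrM ler_nat; apply: leq_trans rest _.
  by rewrite leq_exp2r.
have Ns0 : 0 < N%:R `^ sigma by rewrite powR_gt0.
have -> : N%:R `^ (1 - sigma) = N%:R / N%:R `^ sigma.
  rewrite powRB; last by rewrite (gt_eqF N0) implybT.
  by rewrite powRr1.
rewrite mulrA ltr_pdivlMr //.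
apply: (@le_lt_trans _ _ (E%:R * (C%:R * w))); first by rewrite ler_wpM2l.
rewrite mulrCA; apply: (@le_lt_trans _ _ (C%:R * (K%:R * N%:R))).
  by rewrite ler_wpM2l // ler0n.
have -> : 2 * K%:R * C%:R * c ^+ 6 * N%:R = C%:R * (K%:R * N%:R) * (2 * c ^+ 6).
  by ring.
rewrite ltr_pMr; last by rewrite !mulr_gt0 // (lt_le_trans ltr01).
by rewrite (@lt_le_trans _ _ 2) ?ltr1n // ler_peMr // exprn_ege1.
Qed.
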